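(* Let $L$ be a continuous involutive division of Schreyer type for the term order $\prec$, and let $H=\{h_1,\dots,h_s\}$ be an $L$-ordered involutive basis of the polynomial module $M\subseteq P^m$, $P=\Bbbk[x_1,\dots,x_n]$, with respect to $L$ and $\prec$. Then $H_{\mathrm{Syz}}$ is an involutive basis of the syzygy module $\mathrm{Syz}(H)=\{(S_1,\dots,S_s)\in P^s\mid\sum_\beta S_\beta h_\beta=0\}$ with respect to $L$ and the term order $\prec_H$.
   Context: $\Bbbk$ is a field. An involutive division $L$ assigns to every finite set $N\subset\mathbb{N}_0^n$ and every $\nu\in N$ a set $N_{L,N}(\nu)\subseteq\{1,\dots,n\}$ of multiplicative indices such that the involutive cones $C_{L,N}(\nu)=\{\nu+\rho\mid\rho\in\mathbb{N}_0^n,\ \rho_j=0\text{ for }j\notin N_{L,N}(\nu)\}$ satisfy: (1) if two cones $C_{L,N}(\mu)$, $C_{L,N}(\nu)$ intersect, one is contained in the other; (2) if $\nu\in N'\subset N$, then $N_{L,N}(\nu)\subseteq N_{L,N'}(\nu)$. For $\nu\in N$, $\nu$ is an involutive divisor of $\mu$ if $\mu\in C_{L,N}(\nu)$. A finite set $N$ is involutive if the monoid ideal $N+\mathbb{N}_0^n$ is the disjoint union of the cones $C_{L,N}(\nu)$, $\nu\in N$. $L$ is continuous if for every finite set $N$ and every finite sequence $(\nu^{(1)},\dots,\nu^{(t)})$ of elements of $N$, such that for each $i<t$ there is a non-multiplicative index $j$ of $\nu^{(i)}$ (i.e. $j\notin N_{L,N}(\nu^{(i)})$) for which $\nu^{(i+1)}$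 is an involutive divisor of $\nu^{(i)}+1_j$ ($1_j$ the $j$th unit vector), all elements of the sequence are pairwise distinct. Terms of $P^m$ are $x^\mu e_\alpha$, with $e_1,\dots,e_m$ the standard basis. For a finite set $H\subset P^m\setminus\{0\}$ and each $\alpha$ let $N_\alpha$ be the set of $\mu$ such that $x^\mu e_\alpha$ is the leading term (for $\prec$) of an element of $H$. If $h\in H$ has leading term $x^\mu e_\alpha$, its multiplicative variables are the $x_i$ with $i\in N_{L,N_\alpha}(\mu)$, the remaining variables are non-multiplicative, and its involutive cone is $\{x^\nu e_\alpha\mid\nu\in C_{L,N_\alpha}(\mu)\}$. $H$ is an involutive basis of the submodule $M$ (and $H$ is called involutive) if $H\subset M\setminus\{0\}$ is finite, its elements have pairwise distinct leading terms, and the set of leading terms of non-zero elements of $M$ is the disjoint union of the involutive cones of the elements of $H$. $L$ is of Schreyer type for $\prec$ if for any set $H$ which is involutive with respect to $L$ and $\prec$, and every $h\in H$, the set of non-multiplicative variables of $h$, considered as a set of monomials of degree one, is again involutive for $L$. $L$-graph of an involutive basis $H$: its vertices are (the leading terms of) the elements of $H$, and for each $h\in H$ and each non-multiplicative variable $x_j$ of $h$ there is a directed edge from $h$ to the unique $\bar h\in H$ whose involutive cone contains the leading term of $x_jh$. $H=\{h_1,\dots,h_s\}$ is $L$-ordered if whenever the $L$-graph contains a path from $h_\alpha$ to $h_\beta$ ($\alpha\ne\beta$), then $\alpha<\beta$. For each $\alpha$ and each non-multiplicative variable $x_k$ of $h_\alpha$ there are unique polynomials $P^{(\alpha;k)}_\beta$,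 depending only on the multiplicative variables of $h_\beta$, with $x_kh_\alpha=\sum_\beta P^{(\alpha;k)}_\beta h_\beta$; put $S_{\alpha;k}=x_ke_\alpha-\sum_\beta P^{(\alpha;k)}_\beta e_\beta\in P^s$. $H_{\mathrm{Syz}}$ is the set of all these $S_{\alpha;k}$. The term order $\prec_H$ on the terms of $P^s$: $s\,e_\sigma\prec_Ht\,e_\tau$ if either $\mathrm{lt}_\prec(sh_\sigma)\prec\mathrm{lt}_\prec(th_\tau)$, or $\mathrm{lt}_\prec(sh_\sigma)=\mathrm{lt}_\prec(th_\tau)$ and $\tau<\sigma$, with $\mathrm{lt}_\prec$ the leading term (without coefficient). *)

(* Defs.v *)
From Stdlib Require Import ClassicalEpsilon.
From mathcomp Require Import all_boot all_algebra finmap mpoly.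

Set Implicit Arguments.
Unset Strict Implicit.
Unset Printing Implicit Defensive.

Import GRing.Theory.
Local Open Scope ring_scope.
Local Open Scope fset_scope.

(** * Involutive divisions on the exponent monoid *)

(* Multiplicative indices are given by a total function; its values [N nu] with
   [nu \notin N] are irrelevant, and no axiom below mentions them. *)
Definition inv_cone n (L : {fset 'X_{1..n}} -> 'X_{1..n} -> {set 'I_n})
    (N : {fset 'X_{1..n}}) (nu : 'X_{1..n}) : {pred 'X_{1..n}} :=
  [pred mu : 'X_{1..n} | (nu <= mu)%MM
     && [forall j, (j \notin L N nu) ==> ((mu - nu)%MM j == 0%N)]].

Lemma inv_coneP n (L : {fset 'X_{1..n}} -> 'X_{1..n} -> {set 'I_n}) N nu mu :
  reflect (exists2 rho : 'X_{1..n}, mu = (nu + rho)%MM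
             & forall j, j \notin L N nu -> rho j = 0%N)
          (mu \in inv_cone L N nu).
Proof.
apply: (iffP andP) => [[le_nu /forallP H] | [rho -> H]].
  exists (mu - nu)%MM; first by rewrite addmC submK.
  by move=> j jN; apply/eqP; exact: (implyP (H j)).
split; first by rewrite lem_addr.
by apply/forallP=> j; apply/implyP=> /H; rewrite [(nu + rho)%MM]addmC addmK => ->.
Qed.

Record involutive_division n := InvolutiveDivision {
  mult_idx :> {fset 'X_{1..n}} -> 'X_{1..n} -> {set 'I_n};
  inv_cone_nested : forall (N : {fset 'X_{1..n}}) mu nu rho,
    mu \in N -> nu \in N ->
    rho \in inv_cone mult_idx N mu -> rho \in inv_cone mult_idx N nu ->
    {subset inv_cone mult_idx N mu <= inv_cone mult_idx N nu} \/
    {subset inv_cone mult_idx N nu <= inv_cone mult_idx N mu};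
  mult_idx_sub : forall (N N' : {fset 'X_{1..n}}) nu,
    nu \in N' -> N' `<=` N -> mult_idx N nu \subset mult_idx N' nu
}.

Definition involutive_set n (L : involutive_division n) (N : {fset 'X_{1..n}}) :=
  (forall mu, (exists2 nu, nu \in N & exists rho, mu = (nu + rho)%MM) <->
              (exists2 nu, nu \in N & mu \in inv_cone L N nu)) /\
  {in N &, forall nu nu', nu != nu' ->
     forall mu, ~ (mu \in inv_cone L N nu /\ mu \in inv_cone L N nu')}.

Definition continuous_division n (L : involutive_division n) :=
  forall (N : {fset 'X_{1..n}}) (nus : seq 'X_{1..n}),
    {subset nus <= N} ->
    (forall i, (i.+1 < size nus)%N ->
       exists2 j, j \notin L N (nth 0%MM nus i) &
         (nth 0%MM nus i + U_(j))%MM \in inv_cone L N (nth 0%MM nus i.+1)) ->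
    uniq nus.

(** * Terms of [P^m] and leading terms *)

(* The pair [(mu, a)] stands for the term [x^mu e_a]. *)
Notation mterm n m := ('X_{1..n} * 'I_m)%type.

Definition tmul n m (rho : 'X_{1..n}) (t : mterm n m) : mterm n m :=
  ((rho + t.1)%MM, t.2).

(* [prec] is the strict order. *)
Record term_order n m (prec : rel (mterm n m)) : Prop := TermOrder {
  term_order_irr : irreflexive prec;
  term_order_trans : transitive prec;
  term_order_total : forall s t, s != t -> prec s t || prec t s;
  term_order_mul : forall rho s t, prec s t -> prec (tmul rho s) (tmul rho t);
  term_order_wf : well_founded prec
}.

Definition mterms (K : fieldType) n m (f : 'rV[{mpoly K[n]}]_m) :
    seq (mterm n m) :=
  [seq (u, a) | a <- enum 'I_m, u <- msupp (f 0 a)].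

(* The greatest term of [f], without its coefficient; [None] when [f = 0]. *)
Definition lead_term (K : fieldType) n m (prec : rel (mterm n m))
    (f : 'rV[{mpoly K[n]}]_m) : option (mterm n m) :=
  ohead [seq t <- mterms f | all (fun u => (u == t) || prec u t) (mterms f)].

Lemma mem_mterms (K : fieldType) n m (f : 'rV[{mpoly K[n]}]_m) t :
  (t \in mterms f) = (t.1 \in msupp (f 0 t.2)).
Proof.
apply/allpairsPdep/idP => [[a [u [_ us ->]]] //|ts].
by exists t.2, t.1; rewrite mem_enum; split=> //; case: t {ts}.
Qed.

Lemma lead_termP (K : fieldType) n m (prec : rel (mterm n m))
    (f : 'rV[{mpoly K[n]}]_m) t : term_order prec ->
  lead_term prec f = Some t <->
  t \in mterms f /\ {in mterms f, forall u, u = t \/ prec u t}.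
Proof.
move=> prT; rewrite /lead_term.
have lmaxP v : v \in [seq t <- mterms f | all (fun u => (u == t) || prec u t) (mterms f)]
    <-> v \in mterms f /\ {in mterms f, forall u, u = v \/ prec u v}.
  rewrite mem_filter; split=> [/andP[/allP H vf]|[vf H]].
    by split=> // u /H /orP[/eqP|]; [left|right].
  by rewrite vf andbT; apply/allP=> u /H[->|->]; rewrite ?eqxx ?orbT.
case: [seq _ <- _ | _] lmaxP => [|v r] lmaxP /=.
  by split=> // /(lmaxP t).
have [vf vmax] := (lmaxP v).1 (mem_head _ _).
split=> [[<-] //|[tf tmax]]; congr Some.
case: (vmax t tf) => [-> //|tv]; case: (tmax v vf) => // vt.
by have := term_order_trans prT tv vt; rewrite (term_order_irr prT).
Qed.

Lemma lead_term_neq0 (K : fieldType) n m (prec : rel (mterm n m))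
    (f : 'rV[{mpoly K[n]}]_m) : term_order prec -> f != 0 ->
  exists t, lead_term prec f = Some t.
Proof.
move=> prT f0.
have ex_max (r : seq (mterm n m)) : r != [::] ->
    exists2 t, t \in r & {in r, forall u, u = t \/ prec u t}.
  elim: r => // x r IH _; case: (eqVneq r [::]) => [->|/IH[t tr tmax]].
    by exists x; rewrite ?mem_head // => u; rewrite inE => /eqP; left.
  have [xt|xt] := eqVneq x t.
    exists t; first by rewrite inE tr orbT.
    by move=> u; rewrite inE => /orP[/eqP->|/tmax]; first by left.
  case/orP: (term_order_total prT xt) => lt_xt.
    exists t; first by rewrite inE tr orbT.
    by move=> u; rewrite inE => /orP[/eqP->|/tmax]; first by right.
  exists x; first exact: mem_head.
  move=> u; rewrite inE => /orP[/eqP|/tmax[->|ut]]; [by left|by right|right].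
  exact: (term_order_trans prT ut).
have [|t tf tmax] := ex_max (mterms f); last first.
  by exists t; apply/(lead_termP _ _ prT).
apply: contra_neq f0 => mf0; apply/matrixP=> i a; rewrite ord1 mxE.
apply/eqP; rewrite -msupp_eq0; apply/eqP; case def_r: (msupp _) => [//|u r].
by have := mem_mterms f (u, a); rewrite mf0 /= def_r mem_head.
Qed.

Lemma lead_term_mul (K : fieldType) n m (prec : rel (mterm n m))
    (f : 'rV[{mpoly K[n]}]_m) rho t : term_order prec ->
  lead_term prec f = Some t ->
  lead_term prec ('X_[rho] *: f) = Some (tmul rho t).
Proof.
move=> prT /(lead_termP _ _ prT)[tf tmax]; apply/(lead_termP _ _ prT).
have memX u : u \in mterms ('X_[rho] *: f) <->
    exists2 v, v \in mterms f & u = tmul rho v.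
  rewrite mem_mterms mxE mulrC (perm_mem (msuppMX _ _)).
  split=> [/mapP[v vf uE]|[[v a] + ->]]; last by rewrite mem_mterms => /map_f->.
  by exists (v, u.2); rewrite ?mem_mterms // /tmul /= -uE; case: u {vf uE}.
split=> [|u]; first by apply/memX; exists t.
move=> /memX[v /tmax[->|vt] ->]; first by left.
by right; apply: (term_order_mul prT).
Qed.

(** * Involutive bases *)

Section InvolutiveBases.
Context (K : fieldType) (n m : nat).
Context (L : involutive_division n) (prec : rel (mterm n m)).
Implicit Types (H : {fset 'rV[{mpoly K[n]}]_m}) (h : 'rV[{mpoly K[n]}]_m).

Definition lead_exps H (a : 'I_m) : {fset 'X_{1..n}} :=
  [fset t.1 | t in [seq t <- pmap (lead_term prec) (enum_fset H) | t.2 == a]].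

Definition mult_vars H h : {set 'I_n} :=
  if lead_term prec h is Some t then L (lead_exps H t.2) t.1 else set0.

Definition nonmult_vars H h : {set 'I_n} := ~: mult_vars H h.

Definition module_cone H h : {pred mterm n m} :=
  [pred t : mterm n m | if lead_term prec h is Some u
     then (t.2 == u.2) && (t.1 \in inv_cone L (lead_exps H u.2) u.1)
     else false].

Record involutive_basis (M : {pred 'rV[{mpoly K[n]}]_m}) H : Prop :=
  InvolutiveBasis {
  inv_basis_submod : submod_closed M;
  inv_basis_sub : forall h, h \in H -> h \in M /\ h != 0;
  inv_basis_lead_inj : {in H &, injective (lead_term prec)};
  inv_basis_cover : forall t,
    (exists f, [/\ f \in M, f != 0 & lead_term prec f = Some t]) <->
    (exists2 h, h \in H & t \in module_cone H h);
  inv_basis_disjoint : {in H &, forall h h', h != h' ->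
    forall t, ~ (t \in module_cone H h /\ t \in module_cone H h')}
}.

Definition involutive H := exists M, involutive_basis M H.

End InvolutiveBases.

(* The coefficient field [K] is explicit: it is not determined by [prec]. *)
Definition Schreyer_type (K : fieldType) n m (L : involutive_division n)
    (prec : rel (mterm n m)) :=
  forall H : {fset 'rV[{mpoly K[n]}]_m}, involutive L prec H ->
  {in H, forall h,
    involutive_set L [fset U_(j)%MM | j in nonmult_vars L prec H h]}.

(** * The syzygies of an enumerated involutive basis *)

Section Syzygies.
Context (K : fieldType) (n m s : nat).
Context (L : involutive_division n) (prec : rel (mterm n m)).
Context (h : 'I_s -> 'rV[{mpoly K[n]}]_m).

Definition basis_fset : {fset 'rV[{mpoly K[n]}]_m} := [fset h a | a in 'I_s].

Definition L_graph : rel 'I_s := fun a b =>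
  [exists k, (k \in nonmult_vars L prec basis_fset (h a)) &&
     (if lead_term prec ('X_k *: h a) is Some t
      then t \in module_cone L prec basis_fset (h b) else false)].

Definition L_ordered :=
  forall a b : 'I_s, a != b -> connect L_graph a b -> (a < b)%N.

(* The row [P] collects the coefficients [P_b] of [f]. *)
Definition inv_representation (f : 'rV[{mpoly K[n]}]_m)
    (P : 'rV[{mpoly K[n]}]_s) :=
  (forall b u j, u \in msupp (P 0 b) ->
     j \notin mult_vars L prec basis_fset (h b) -> u j = 0%N) /\
  f = \sum_b P 0 b *: h b.

(* [epsilon] names the representation of [x_k h_a], which exists and is unique
   as soon as [basis_fset] is an involutive basis of a submodule for a term
   order; otherwise the value is unspecified. *)
Definition inv_coeffs (a : 'I_s) (k : 'I_n) : 'rV[{mpoly K[n]}]_s :=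
  epsilon (inhabits 0) (inv_representation ('X_k *: h a)).

Definition Ssyz (a : 'I_s) (k : 'I_n) : 'rV[{mpoly K[n]}]_s :=
  'X_k *: delta_mx 0 a - \sum_b inv_coeffs a k 0 b *: delta_mx 0 b.

Definition Hsyz : {fset 'rV[{mpoly K[n]}]_s} :=
  [fset Ssyz ak.1 ak.2 | ak in
     [set ak : 'I_s * 'I_n | ak.2 \in nonmult_vars L prec basis_fset (h ak.1)]].

Definition Syz : {pred 'rV[{mpoly K[n]}]_s} :=
  [pred S : 'rV[{mpoly K[n]}]_s | \sum_b S 0 b *: h b == 0].

Definition schreyer_order : rel (mterm n s) := fun t u =>
  match lead_term prec ('X_[t.1] *: h t.2), lead_term prec ('X_[u.1] *: h u.2) with
  | Some t', Some u' => prec t' u' || ((t' == u') && (u.2 < t.2)%N)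
  | _, _ => false
  end.

End Syzygies.

Lemma schreyer_term_order (K : fieldType) n m s (prec : rel (mterm n m))
    (h : 'I_s -> 'rV[{mpoly K[n]}]_m) :
  term_order prec -> (forall a, h a != 0) -> term_order (schreyer_order prec h).
Proof.
move=> prT h0.
have [l lE] : exists l, forall t,
    lead_term prec ('X_[t.1] *: h t.2) = Some (tmul t.1 (l t.2)).
  pose P a t := lead_term prec (h a) = Some t.
  have ex a : {t | P a t}.
    exact: constructive_indefinite_description (lead_term_neq0 prT (h0 a)).
  by exists (fun a => sval (ex a)) => t; apply: lead_term_mul => //; case: (ex _).
have soE t u : schreyer_order prec h t u =
    prec (tmul t.1 (l t.2)) (tmul u.1 (l u.2)) ||
    ((tmul t.1 (l t.2) == tmul u.1 (l u.2)) && (u.2 < t.2)%N).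
  by rewrite /schreyer_order !lE.
split.
- by move=> t; rewrite soE (term_order_irr prT) ltnn andbF.
- move=> u t v; rewrite !soE => /orP[tu|/andP[/eqP-> ut]] /orP[uv|/andP[/eqP<- vu]].
  + by rewrite (term_order_trans prT tu uv).
  + by rewrite tu.
  + by rewrite uv.
  + by rewrite eqxx (ltn_trans vu ut) orbT.
- move=> t u tu; rewrite !soE.
  have [E|/(term_order_total prT)/orP[->|->]] :=
    eqVneq (tmul t.1 (l t.2)) (tmul u.1 (l u.2)); rewrite ?orbT //.
  rewrite E (term_order_irr prT) /=.
  have [| |/val_inj E2] := ltngtP u.2 t.2; rewrite ?orbT //.
  case: t u tu E E2 => [t a] [u b] /= tu E E2; move: E tu; rewrite E2.
  move=> /(congr1 (fun v => v.1 - (l a).1)%MM) /=.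
  by rewrite !addmK => ->; rewrite eqxx.
- move=> rho t u; rewrite !soE /=.
  have tmulD v w : tmul (rho + v) w = tmul rho (tmul v w) :> mterm n m.
    by rewrite /tmul /= addmA.
  rewrite !tmulD => /orP[/(term_order_mul prT rho)-> //|/andP[/eqP-> ->]].
  by rewrite eqxx orbT.
- suff wf y : forall t, tmul t.1 (l t.2) = y -> Acc (schreyer_order prec h) t.
    by move=> t; apply: (wf _ t erefl).
  elim/(well_founded_ind (term_order_wf prT)): y => y IHy t.
  move: {2}(s - t.2)%N (leqnn (s - t.2)%N) => k.
  elim: k t => [|k IHk] t ltk tE.
    by move: ltk; rewrite leqn0 subn_eq0 leqNgt ltn_ord.
  constructor=> u; rewrite soE tE => /orP[uy|/andP[/eqP uE tu]].
    exact: IHy uy _ erefl.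
  apply: (IHk _ _ uE); rewrite -ltnS; apply: leq_trans ltk.
  exact: ltn_sub2l (ltn_ord _) tu.
Qed.

(* Main.v *)
(** The involutive representation of [x_k h_a] has exactly one summand with the
leading term of [x_k h_a]; it belongs to some [h_b] with an edge from [h_a] to
[h_b], so [a < b] and [lt S_{a;k} = x_k e_a].  By the Schreyer property the
involutive cones of the [S_{a;k}] therefore partition the terms [x^mu e_a] in
which some non-multiplicative variable of [h_a] occurs.  Subtracting multiples
of the [S_{a;k}] turns any vector into one with multiplicative entries only,
and such a vector is a syzygy only if it is zero; so no leading term of a
syzygy can be purely multiplicative. *)
Require Import Defs.
From Stdlib Require Import ClassicalEpsilon.
From mathcomp Require Import all_boot all_algebra finmap mpoly.

Set Implicit Arguments.
Unset Strict Implicit.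
Unset Printing Implicit Defensive.

Import GRing.Theory.
Local Open Scope ring_scope.

(** * Terms, coefficients and the cancellation of leading terms *)

Section Terms.
Context (K : fieldType) (n m : nat).
Implicit Types (f g : 'rV[{mpoly K[n]}]_m) (t u : mterm n m).

Definition tcoeff f t : K := (f 0 t.2)@_t.1.

Definition tmon t : 'rV[{mpoly K[n]}]_m := 'X_[t.1] *: delta_mx 0 t.2.

Lemma tmul_inj t : injective (fun rho => tmul rho t).
Proof. by move=> rho sigma /(congr1 fst)/= E; rewrite -(addmK t.1 rho) E addmK. Qed.

Lemma mem_mtermsE f t : (t \in mterms f) = (tcoeff f t != 0).
Proof. by rewrite mem_mterms mcoeff_msupp. Qed.

Lemma tcoeffD f g t : tcoeff (f + g) t = tcoeff f t + tcoeff g t.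
Proof. by rewrite /tcoeff mxE mcoeffD. Qed.

Lemma tcoeffN f t : tcoeff (- f) t = - tcoeff f t.
Proof. by rewrite /tcoeff mxE mcoeffN. Qed.

Lemma tcoeffZ c f t : tcoeff (c%:MP *: f) t = c * tcoeff f t.
Proof. by rewrite /tcoeff mxE mcoeffCM. Qed.

Lemma tcoeff_tmon t u : tcoeff (tmon t) u = (u == t)%:R.
Proof.
case: t u => [mu a] [nu b]; rewrite /tcoeff /tmon !mxE eqxx /= xpair_eqE.
case: (b == a); last by rewrite andbF mulr0 mcoeff0.
by rewrite andbT mulr1 mcoeffX eq_sym.
Qed.

Lemma mem_mtermsD f g t : t \in mterms (f + g) -> t \in mterms f \/ t \in mterms g.
Proof.
rewrite !mem_mtermsE tcoeffD.
by have [->|] := eqVneq (tcoeff f t) 0; [rewrite add0r; right|left].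
Qed.

Lemma mem_mtermsN f t : (t \in mterms (- f)) = (t \in mterms f).
Proof. by rewrite !mem_mtermsE tcoeffN oppr_eq0. Qed.

Lemma mem_mtermsZ c f t : t \in mterms (c%:MP *: f) -> t \in mterms f.
Proof. by rewrite !mem_mtermsE tcoeffZ mulf_eq0 negb_or => /andP[]. Qed.

Lemma mem_mterms_tmon t u : (u \in mterms (tmon t)) = (u == t).
Proof. by rewrite mem_mtermsE tcoeff_tmon; case: (u == t); rewrite ?oner_eq0 ?eqxx. Qed.

Lemma mterms0 t : (t \in mterms (0 : 'rV[{mpoly K[n]}]_m)) = false.
Proof. by rewrite mem_mtermsE /tcoeff mxE mcoeff0 eqxx. Qed.

Context (prec : rel (mterm n m)) (prT : term_order prec).

Lemma lead_term_tmon t : lead_term prec (tmon t) = Some t.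
Proof.
apply/(lead_termP _ _ prT); rewrite mem_mterms_tmon; split=> // u.
by rewrite mem_mterms_tmon => /eqP; left.
Qed.

(** The quotient of the two leading coefficients cancels [t], and no larger term exists on either
    side. The strict drop drives the well-founded inductions below, while [c != 0] yields the
    contradictions about syzygies. *)
Lemma lead_term_reduce f g t :
  lead_term prec f = Some t -> lead_term prec g = Some t ->
  exists2 c, c != 0 & {in mterms (f - c%:MP *: g), forall u, prec u t}.
Proof.
move=> /(lead_termP _ _ prT)[tf maxf] /(lead_termP _ _ prT)[tg maxg].
move: (tf) (tg); rewrite !mem_mtermsE => f0 g0.
exists (tcoeff f t / tcoeff g t); first by rewrite mulf_neq0 ?invr_neq0.
move=> u uf.
have [|//] : u = t \/ prec u t.
  case: (mem_mtermsD uf) => [/maxf //|]; rewrite mem_mtermsN.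
  by move=> /mem_mtermsZ/maxg.
move=> ut; move: uf.
by rewrite ut mem_mtermsE tcoeffD tcoeffN tcoeffZ divfK // subrr eqxx.
Qed.

Lemma module_coneP (L : involutive_division n) H f t u : lead_term prec f = Some t ->
  reflect (exists2 rho, u = tmul rho t &
             forall j, j \notin mult_vars L prec H f -> rho j = 0%N)
          (u \in module_cone L prec H f).
Proof.
move=> lf; rewrite inE /mult_vars lf; apply: (iffP andP).
  case: u => [mu b] /= [/eqP-> /inv_coneP[rho -> rhoP]].
  by exists rho; rewrite // /tmul /= addmC.
case=> rho -> rhoP; split=> //; apply/inv_coneP.
by exists rho; rewrite // /tmul /= addmC.
Qed.

End Terms.

(** * Involutive representations: existence and uniqueness *)

Section Syzygies.
Context (K : fieldType) (n m s : nat).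
Context (L : involutive_division n) (prec : rel (mterm n m)).
Context (M : {pred 'rV[{mpoly K[n]}]_m}) (h : 'I_s -> 'rV[{mpoly K[n]}]_m).
Context (l : 'I_s -> mterm n m).
Context (prT : term_order prec) (h_inj : injective h).
Context (HM : involutive_basis L prec M (basis_fset h)).
Context (lE : forall a, lead_term prec (h a) = Some (l a)).
Implicit Types (t u : mterm n s) (P R S : 'rV[{mpoly K[n]}]_s).

Local Notation nonmult a := (nonmult_vars L prec (basis_fset h) (h a)).
Local Notation prec_h := (schreyer_order prec h).
(** The map sending [e_b] to [h b], with kernel [Syz h]; as a matrix product it inherits its
    linearity from [*m]. *)
Local Notation phi S := (S *m (\matrix_b h b)).

Definition mult_term t := forall j, j \in nonmult t.2 -> t.1 j = 0%N.

(** This is the leading term of the product that [t] stands for, the first thing [prec_h] compares.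
    The function [l] avoids the [option] in [lead_term]. *)
Definition hlead t : mterm n m := tmul t.1 (l t.2).

Lemma mem_basis a : h a \in basis_fset h.
Proof. exact: in_imfset. Qed.

Lemma h_neq0 a : h a != 0.
Proof. by have [] := inv_basis_sub HM (mem_basis a). Qed.

Lemma prec_hT : term_order prec_h.
Proof. exact: schreyer_term_order prT h_neq0. Qed.

Lemma lead_term_mulh t : lead_term prec ('X_[t.1] *: h t.2) = Some (hlead t).
Proof. exact: lead_term_mul. Qed.

Lemma prec_hE t u : prec_h t u =
  prec (hlead t) (hlead u) || ((hlead t == hlead u) && (u.2 < t.2)%N).
Proof. by rewrite /schreyer_order !lead_term_mulh. Qed.

Lemma phiE S : phi S = \sum_b S 0 b *: h b.
Proof. by rewrite mulmx_sum_row; apply: eq_bigr => b _; rewrite rowK. Qed.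

Lemma phi_tmon t : phi (tmon K t) = 'X_[t.1] *: h t.2.
Proof. by rewrite /tmon -scalemxAl -rowE rowK. Qed.

Lemma mem_Syz S : (S \in Syz h) = (phi S == 0).
Proof. by rewrite inE phiE. Qed.

Lemma Syz_submod : submod_closed (Syz h).
Proof.
split=> [|c S T]; rewrite !mem_Syz ?mul0mx // => /eqP S0 /eqP T0.
by rewrite mulmxDl -scalemxAl S0 T0 scaler0 addr0.
Qed.

(** Cones become images of multiplicative terms under [hlead]: covering turns into surjectivity onto
    the leading terms of [M], disjointness into injectivity. *)
Lemma hconeP b (w : mterm n m) :
  reflect (exists t, [/\ t.2 = b, mult_term t & hlead t = w])
          (w \in module_cone L prec (basis_fset h) (h b)).
Proof.
apply: (iffP (module_coneP _ _ _ (lE b))) => [[rho -> rhoP]|[[rho a] /= [<- rhoP <-]]].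
  by exists (rho, b); split=> // j; rewrite inE => /rhoP.
by exists rho => // j jN; apply: rhoP; rewrite inE.
Qed.

Lemma hlead_inj t u : mult_term t -> mult_term u -> hlead t = hlead u -> t = u.
Proof.
move=> tM uM tu.
have E : t.2 = u.2.
  apply/eqP/negPn/negP=> ne.
  have ne' : h t.2 != h u.2 by apply: contra ne => /eqP/h_inj ->.
  apply: (inv_basis_disjoint HM (mem_basis _) (mem_basis _) ne' (t := hlead t)).
  by split; apply/hconeP; [exists t|exists u].
case: t u E tu {tM uM} => [mu a] [nu b] /= -> E.
by rewrite (tmul_inj E : mu = nu).
Qed.

(** No term of a product [x^nu h_b] exceeds its leading term, so a bound on the leading products
    bounds every summand and hence the sum. *)
Lemma phi_below P (w : mterm n m) : {in mterms P, forall t, prec (hlead t) w} ->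
  {in mterms (phi P), forall v, prec v w}.
Proof.
move=> Pw; rewrite phiE.
apply: (big_ind (fun f => {in mterms f, forall v, prec v w})) => [v|f g IHf IHg v|b _].
- by rewrite mterms0.
- by case/mem_mtermsD => [/IHf|/IHg].
rewrite [P 0 b]mpolyE big_seq scaler_suml.
apply: (big_ind (fun f => {in mterms f, forall v, prec v w})) => [v|f g IHf IHg v|nu nuP v].
- by rewrite mterms0.
- by case/mem_mtermsD => [/IHf|/IHg].
rewrite -mul_mpolyC -scalerA => /mem_mtermsZ.
have := lead_term_mulh (nu, b) => /(lead_termP _ _ prT)[_ max] /max vle.
have {Pw} nuw : prec (hlead (nu, b)) w by apply: Pw; rewrite mem_mterms.
by case: vle => [-> //|vlt]; apply: term_order_trans prT _ _ _ vlt nuw.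
Qed.

Lemma inv_representationP f P :
  inv_representation L prec h f P <-> {in mterms P, forall t, mult_term t} /\ f = phi P.
Proof.
rewrite phiE; split=> -[PM ->]; split=> //.
  move=> [u b] /=; rewrite mem_mterms => /= uP j.
  by rewrite inE => /(PM b u j uP).
move=> b u j uP jN; apply: (PM (u, b)); last by rewrite inE.
by rewrite mem_mterms.
Qed.

(* With multiplicative entries, distinct terms of [R] have distinct leading
   products, so the greatest one cannot cancel. *)
Lemma mult_Syz_eq0 R : {in mterms R, forall t, mult_term t} -> phi R = 0 -> R = 0.
Proof.
move=> RM R0; apply/eqP/negPn/negP=> /(lead_term_neq0 prec_hT)[t lt].
have [c c0 Rlt] := lead_term_reduce prec_hT lt (lead_term_tmon K prec_hT t).
have [tR _] := (lead_termP _ _ prec_hT).1 lt.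
pose R' := R - c%:MP *: tmon K t.
have R'lt : {in mterms R', forall u, prec (hlead u) (hlead t)}.
  move=> u uR'; have := Rlt u uR'; rewrite prec_hE => /orP[//|/andP[/eqP ut _]].
  have uR : u \in mterms R.
    case: (mem_mtermsD uR') => //; rewrite mem_mtermsN => /mem_mtermsZ.
    by rewrite mem_mterms_tmon => /eqP->.
  (* A tie under [hlead], which [prec_h] alone would allow, forces [u = t] between multiplicative
     terms. *)
  have E := hlead_inj (RM _ uR) (RM _ tR) ut.
  by have := Rlt u uR'; rewrite E (term_order_irr prec_hT).
(* Since [phi R = 0], [phi R'] is [-c] times a product with leading term [hlead t]. *)
have : hlead t \in mterms (phi R').
  rewrite /R' mulmxBl R0 sub0r mem_mtermsN -scalemxAl phi_tmon.
  have [+ _] := (lead_termP _ _ prT).1 (lead_term_mulh t).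
  by rewrite !mem_mtermsE tcoeffZ; apply: mulf_neq0.
by move/(phi_below R'lt); rewrite (term_order_irr prT).
Qed.

(** One step of involutive division: the cone containing [w] supplies a multiplicative cofactor, and
    the remainder stays in [M]. *)
Lemma lead_reduce_basis f (w : mterm n m) : f \in M -> lead_term prec f = Some w ->
  exists t c, [/\ mult_term t, hlead t = w, f - c%:MP *: ('X_[t.1] *: h t.2) \in M &
    {in mterms (f - c%:MP *: ('X_[t.1] *: h t.2)), forall v, prec v w}].
Proof.
move=> fM lf; have f0 : f != 0.
  by apply/eqP=> f0; have [] := (lead_termP _ _ prT).1 lf; rewrite f0 mterms0.
have [|g /imfsetP[b _ ->] /hconeP[t [_ tM tw]]] := (inv_basis_cover HM w).1.
  by exists f.
have [c _ clt] := lead_term_reduce prT lf (etrans (lead_term_mulh t) (congr1 Some tw)).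
exists t, c; split=> //; have [_ Mlin] := inv_basis_submod HM.
rewrite scalerA -scaleNr addrC; apply: Mlin => //.
by have [] := inv_basis_sub HM (mem_basis t.2).
Qed.

(** Iterated involutive division, by induction on the bound [w]. The bound reappears in the
    conclusion because [inv_coeffsP] needs it for the tail of [x_k h_a]. *)
Lemma inv_representation_ex (w : mterm n m) f :
  f \in M -> {in mterms f, forall v, prec v w} ->
  exists P, [/\ {in mterms P, forall t, mult_term t}, f = phi P &
    {in mterms P, forall t, prec (hlead t) w}].
Proof.
elim/(well_founded_ind (term_order_wf prT)): w f => w IH f fM flt.
have [->|/(lead_term_neq0 prT)[v lf]] := eqVneq f 0.
  by exists 0; split=> [t||t]; rewrite ?mul0mx // mterms0.
have vw : prec v w by apply: flt; have [] := (lead_termP _ _ prT).1 lf.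
have [t [c [tM tv f'M f'lt]]] := lead_reduce_basis fM lf.
have [P [PM fP Plt]] := IH v vw _ f'M f'lt.
exists (P + c%:MP *: tmon K t); split=> [u||u].
- by case/mem_mtermsD=> [/PM //|/mem_mtermsZ]; rewrite mem_mterms_tmon => /eqP->.
- by rewrite mulmxDl -fP -scalemxAl phi_tmon subrK.
case/mem_mtermsD=> [/Plt uv|/mem_mtermsZ]; first exact: (term_order_trans prT uv vw).
by rewrite mem_mterms_tmon => /eqP->; rewrite tv.
Qed.

Lemma inv_representation_uniq f P R :
  inv_representation L prec h f P -> inv_representation L prec h f R -> P = R.
Proof.
move=> /inv_representationP[PM ->] /inv_representationP[RM PR].
apply/eqP; rewrite -subr_eq0; apply/eqP/mult_Syz_eq0; last by rewrite mulmxBl PR subrr.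
by move=> t /mem_mtermsD[/PM //|]; rewrite mem_mtermsN => /RM.
Qed.

Lemma SsyzE a k : Ssyz L prec h a k = tmon K (U_(k)%MM, a) - inv_coeffs L prec h a k.
Proof. by rewrite /Ssyz -row_sum_delta. Qed.

(** * Leading terms of the syzygies [Ssyz] *)

Context (hord : L_ordered L prec h).

Lemma inv_coeffsP a k : k \in nonmult a ->
  let P := inv_coeffs L prec h a k in
  [/\ {in mterms P, forall t, mult_term t}, phi P = 'X_k *: h a &
      {in mterms P, forall t, prec_h t (U_(k)%MM, a)}].
Proof.
move=> kN P; have lf := lead_term_mulh (U_(k)%MM, a); rewrite /= in lf.
have fM : 'X_k *: h a \in M.
  have [M0 Mlin] := inv_basis_submod HM.
  rewrite -[_ *: _]addr0; apply: Mlin => //.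
  by have [] := inv_basis_sub HM (mem_basis a).
(* Splitting off the leading term first leaves [t] as the only term that can tie with [x_k e_a]
   under [hlead]. *)
have [t [c [tM tw f'M f'lt]]] := lead_reduce_basis fM lf.
have [P' [P'M fP' P'lt]] := inv_representation_ex f'M f'lt.
have rep : inv_representation L prec h ('X_k *: h a) (P' + c%:MP *: tmon K t).
  apply/inv_representationP; split=> [u|]; last first.
    by rewrite mulmxDl -fP' -scalemxAl phi_tmon subrK.
  by case/mem_mtermsD=> [/P'M //|/mem_mtermsZ]; rewrite mem_mterms_tmon => /eqP->.
have repP : inv_representation L prec h ('X_k *: h a) P.
  by apply: epsilon_spec; exists (P' + c%:MP *: tmon K t).
(* Uniqueness identifies the value chosen by [epsilon] with the representation just built, whose
   terms are under control. *)
have PE := inv_representation_uniq repP rep.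
have [PM fP] := (inv_representationP _ _).1 repP.
split=> // u; rewrite PE prec_hE => /mem_mtermsD[/P'lt -> //|/mem_mtermsZ].
rewrite mem_mterms_tmon => /eqP->; rewrite tw eqxx /=; apply/orP; right.
(* [L_ordered] speaks of distinct indices, so a loop must be excluded: with [t.2 = a], cancelling
   [l a] gives [t.1 = U_(k)], but [x_k] is non-multiplicative for [h a]. *)
have at2 : a != t.2.
  apply/eqP=> at2; move: tM tw; rewrite /mult_term -at2 => /(_ k kN) tk.
  rewrite /hlead -at2 => /tmul_inj /= tU.
  by move: tk; rewrite tU mnmE eqxx.
apply: hord at2 _; apply: connect1; apply/existsP; exists k.
by rewrite kN lf; apply/hconeP; exists t.
Qed.

Lemma lead_Ssyz a k : k \in nonmult a ->
  lead_term prec_h (Ssyz L prec h a k) = Some (U_(k)%MM, a).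
Proof.
move=> kN; have [PM _ Plt] := inv_coeffsP kN; rewrite SsyzE.
apply/(lead_termP _ _ prec_hT); split=> [|u].
  rewrite mem_mtermsE tcoeffD tcoeffN tcoeff_tmon eqxx.
  (* The term [x_k e_a] is not multiplicative, so it is absent from [inv_coeffs] and keeps
     coefficient 1. *)
  have := PM (U_(k)%MM, a); rewrite mem_mtermsE; case: eqP => [-> _|_ /(_ isT k kN)].
    by rewrite subr0 oner_eq0.
  by rewrite /= mnmE eqxx.
case/mem_mtermsD; first by rewrite mem_mterms_tmon => /eqP; left.
by rewrite mem_mtermsN => /Plt; right.
Qed.

Lemma phi_Ssyz a k : k \in nonmult a -> phi (Ssyz L prec h a k) = 0.
Proof. by move=> /inv_coeffsP[_ fP _]; rewrite SsyzE mulmxBl fP phi_tmon subrr. Qed.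

Lemma HsyzP S :
  reflect (exists a k, k \in nonmult a /\ S = Ssyz L prec h a k) (S \in Hsyz L prec h).
Proof.
apply: (iffP (imfsetP _ _ _ _)) => [[[a k] /= + ->]|[a [k [kN ->]]]].
  by rewrite inE => kN; exists a, k.
by exists (a, k); rewrite //= inE.
Qed.

(** The link to the Schreyer property: the cones of [Hsyz] in component [a] are those of the very
    set that this property makes involutive. *)
Lemma lead_exps_Hsyz a :
  lead_exps prec_h (Hsyz L prec h) a = [fset U_(j)%MM | j in nonmult a]%fset.
Proof.
apply/fsetP=> mu; apply/imfsetP/imfsetP => [[[nu b] /= + ->]|[k kN ->]].
  rewrite mem_filter mem_pmap => /andP[/eqP /= -> /mapP[S /HsyzP[c [k [kN ->]]]]].
  by rewrite (lead_Ssyz kN) => -[-> ca]; exists k; rewrite // ca.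
exists (U_(k)%MM, a) => //=; rewrite mem_filter eqxx mem_pmap; apply/mapP.
by exists (Ssyz L prec h a k); [apply/HsyzP; exists a, k|rewrite lead_Ssyz].
Qed.

Lemma Hsyz_coneE a k t : k \in nonmult a ->
  (t \in module_cone L prec_h (Hsyz L prec h) (Ssyz L prec h a k)) =
  (t.2 == a) && (t.1 \in inv_cone L [fset U_(j)%MM | j in nonmult a]%fset U_(k)%MM).
Proof. by move=> kN; rewrite inE lead_Ssyz //= lead_exps_Hsyz. Qed.

(** * Normal forms modulo [Hsyz] and leading terms of syzygies *)

Lemma mult_term_dec t : mult_term t \/
  exists2 k, k \in nonmult t.2 & (U_(k) <= t.1)%MM.
Proof.
have [/existsP[k /andP[kN k0]]|] := boolP [exists k, (k \in nonmult t.2) && (t.1 k != 0%N)].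
  by right; exists k; rewrite ?lep1mP.
rewrite negb_exists => /forallP tM; left=> j jN.
by have := tM j; rewrite jN /= negbK => /eqP.
Qed.

(** A multiplicative leading term is moved into [R]; any other is removed by a multiple of some
    [Ssyz], which [phi] kills. Both lower the bound. *)
Lemma normal_form t S : {in mterms S, forall u, prec_h u t} ->
  exists R, [/\ {in mterms R, forall u, mult_term u}, phi R = phi S &
    {in mterms R, forall u, prec_h u t}].
Proof.
elim/(well_founded_ind (term_order_wf prec_hT)): t S => t IH S Slt.
have [->|/(lead_term_neq0 prec_hT)[v lS]] := eqVneq S 0.
  by exists 0; split=> // u; rewrite mterms0.
have vt : prec_h v t by apply: Slt; have [] := (lead_termP _ _ prec_hT).1 lS.
have [vM|[k kN kv]] := mult_term_dec v.
  have [c _ clt] := lead_term_reduce prec_hT lS (lead_term_tmon K prec_hT v).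
  have [R [RM RS Rlt]] := IH v vt _ clt.
  exists (R + c%:MP *: tmon K v); split=> [u||u].
  - by case/mem_mtermsD=> [/RM //|/mem_mtermsZ]; rewrite mem_mterms_tmon => /eqP->.
  - by rewrite mulmxDl RS -mulmxDl subrK.
  case/mem_mtermsD=> [/Rlt uv|/mem_mtermsZ]; first exact: (term_order_trans prec_hT uv vt).
  by rewrite mem_mterms_tmon => /eqP->.
(* The cofactor [v / x_k] lifts the leading term of [Ssyz] to exactly [v]. *)
have := lead_term_mul (v.1 - U_(k))%MM prec_hT (lead_Ssyz kN).
rewrite /tmul /= submK // -surjective_pairing => lv.
have [c _ clt] := lead_term_reduce prec_hT lS lv.
have [R [RM RS Rlt]] := IH v vt _ clt.
exists R; split=> // [|u /Rlt uv]; last exact: (term_order_trans prec_hT uv vt).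
by rewrite RS mulmxBl -!scalemxAl phi_Ssyz // !scaler0 subr0.
Qed.

Lemma lead_Syz_nonmult S t : phi S = 0 -> lead_term prec_h S = Some t ->
  exists2 k, k \in nonmult t.2 & (U_(k) <= t.1)%MM.
Proof.
move=> S0 lS; have [tM|//] := mult_term_dec t; exfalso.
(* Only the tail is reduced. Its normal form [R] stays below [t], so [t] has coefficient [c] in the
   multiplicative syzygy obtained by adding [t] back; that syzygy is zero. *)
have [c c0 clt] := lead_term_reduce prec_hT lS (lead_term_tmon K prec_hT t).
have [R [RM RS Rlt]] := normal_form clt.
have R0 : R + c%:MP *: tmon K t = 0.
  apply: mult_Syz_eq0; last by rewrite mulmxDl RS -mulmxDl subrK.
  by move=> u /mem_mtermsD[/RM //|/mem_mtermsZ]; rewrite mem_mterms_tmon => /eqP->.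
have := tcoeffD R (c%:MP *: tmon K t) t.
rewrite R0 tcoeffZ tcoeff_tmon eqxx mulr1 {1}/tcoeff mxE mcoeff0.
have -> : tcoeff R t = 0.
  apply/eqP/negPn; rewrite -mem_mtermsE; apply/negP=> /Rlt.
  by rewrite (term_order_irr prec_hT).
by rewrite add0r => /esym/eqP; rewrite (negPf c0).
Qed.

(** * The involutive basis of the syzygy module *)

Lemma Hsyz_involutive_basis :
  (forall a, involutive_set L [fset U_(j)%MM | j in nonmult a]%fset) ->
  involutive_basis L prec_h (Syz h) (Hsyz L prec h).
Proof.
move=> invN.
have lead_neq0 S t : lead_term prec_h S = Some t -> S != 0.
  by move=> lS; apply/eqP=> S0; have [] := (lead_termP _ _ prec_hT).1 lS; rewrite S0 mterms0.
split.
- exact: Syz_submod.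
- move=> S /HsyzP[a [k [kN ->]]]; rewrite mem_Syz phi_Ssyz // eqxx; split=> //.
  exact: lead_neq0 (lead_Ssyz kN).
- move=> S T /HsyzP[a [k [kN SE]]] /HsyzP[b [j [jN TE]]] lST.
  have [kj ab] : k = j /\ a = b.
    have := lead_Ssyz jN; rewrite -TE -lST SE (lead_Ssyz kN) => /Some_inj/eqP.
    by rewrite xpair_eqE eq_mnm1 => /andP[/eqP-> /eqP->].
  by move: SE TE; rewrite kj ab => -> ->.
- move=> t; split=> [[S [+ _ lS]]|[_ /HsyzP[a [k [kN ->]]]]].
    (* A non-multiplicative variable divides [t], so [t.1] lies in the monoid ideal that the cones
       in [invN] cover. *)
    rewrite mem_Syz => /eqP S0; have [k kN kt] := lead_Syz_nonmult S0 lS.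
    have [|nu /imfsetP[j jN ->] tj] := ((invN t.2).1 t.1).1.
      exists U_(k)%MM; first exact: in_imfset.
      by exists (t.1 - U_(k))%MM; rewrite addmC submK.
    exists (Ssyz L prec h t.2 j); first by apply/HsyzP; exists t.2, j.
    by rewrite Hsyz_coneE // eqxx.
  move=> /(module_coneP _ _ _ (lead_Ssyz kN))[rho -> _].
  have lS := lead_term_mul rho prec_hT (lead_Ssyz kN).
  exists ('X_[rho] *: Ssyz L prec h a k); split=> //; last exact: lead_neq0 lS.
  by rewrite mem_Syz -scalemxAl phi_Ssyz // scaler0.
- move=> S T /HsyzP[a [k [kN SE]]] /HsyzP[b [j [jN TE]]] ne t [].
  rewrite {1}SE Hsyz_coneE // => /andP[/eqP ta tk].
  rewrite {1}TE Hsyz_coneE // => /andP[/eqP tb tj].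
  (* Cones in different components cannot meet; within one, [invN] separates distinct variables. *)
  have ab : a = b by rewrite -ta.
  rewrite -{b tb}ab in jN TE tj.
  apply: ((invN a).2 U_(k)%MM U_(j)%MM _ _ _ t.1) => //; try exact: in_imfset.
  apply: contra ne; rewrite eq_mnm1 => /eqP kj.
  by move: SE TE; rewrite kj => -> ->.
Qed.

End Syzygies.

Theorem theorem5p10 (K : fieldType) (n m s : nat)
    (L : involutive_division n) (prec : rel (mterm n m))
    (M : {pred 'rV[{mpoly K[n]}]_m}) (h : 'I_s -> 'rV[{mpoly K[n]}]_m) :
  term_order prec ->
  continuous_division L ->
  Schreyer_type K L prec ->
  injective h ->
  involutive_basis L prec M (basis_fset h) ->
  L_ordered L prec h ->
  involutive_basis L (schreyer_order prec h) (Syz h) (Hsyz L prec h).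
Proof.
move=> prT _ LS h_inj HM hord.
have ex a : {t | lead_term prec (h a) = Some t}.
  apply: constructive_indefinite_description; apply: lead_term_neq0 => //.
  exact: h_neq0 HM a.
apply: (Hsyz_involutive_basis prT h_inj HM (l := fun a => sval (ex a))) => //.
  by move=> a; case: (ex a).
(* The Schreyer property is applied to [basis_fset h] itself. *)
move=> a; apply: LS; first by exists M.
exact: mem_basis.
Qed.
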